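(* Consider $\mathbb{Q}$ as a dihedral rack with operation $x\triangleright y=2x-y$. Then the lattice $\mathcal{R}(\mathbb{Q})$ of subracks of $\mathbb{Q}$ is not complemented.
   Context: A rack is a set $R$ with a binary operation $\triangleright$ such that $a\triangleright(b\triangleright c)=(a\triangleright b)\triangleright(a\triangleright c)$ for all $a,b,c\in R$, and for all $a,b\in R$ there is a unique $x\in R$ with $a\triangleright x=b$. A subrack is a subset $Q$ with $(Q,\triangleright)$ a rack (including $\emptyset$); $\ll S\gg$ is the intersection of all subracks containing $S$. $\mathcal{R}(R)$ is the lattice of subracks ordered by inclusion, with meet the intersection, join $\ll Q\cup Q'\gg$, bottom $\emptyset$ and top $R$. It is complemented if every subrack $Q$ has a subrack $Q'$ with $Q\cap Q'=\emptyset$ and $\ll Q\cup Q'\gg=R$. *)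

(* Defs.v *)
From HB Require Import structures.
From mathcomp Require Import all_boot all_order all_algebra.
From mathcomp Require Import boolp classical_sets.

Set Implicit Arguments.
Unset Strict Implicit.
Unset Printing Implicit Defensive.

Import Order.TTheory GRing.Theory.

Local Open Scope classical_set_scope.

Reserved Notation "a ▷ b" (at level 40, no associativity).

HB.mixin Record isRack R := {
  rack_op : R -> R -> R;
  rack_opD : forall a b c,
    rack_op a (rack_op b c) = rack_op (rack_op a b) (rack_op a c);
  rack_div : forall a b, exists! x, rack_op a x = b
}.

#[short(type="rackType")]
HB.structure Definition Rack := { R of isRack R }.

Notation "a ▷ b" := (rack_op a b).

(* The rack axioms for the operation restricted to [Q]; the left division has
   to be possible inside [Q], which closure alone does not guarantee. *)
Definition is_subrack (R : rackType) (Q : set R) : Prop :=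
  [/\ forall a b, Q a -> Q b -> Q (a ▷ b),
      forall a b c, Q a -> Q b -> Q c -> a ▷ (b ▷ c) = (a ▷ b) ▷ (a ▷ c)
    & forall a b, Q a -> Q b -> exists! x, Q x /\ a ▷ x = b].

Definition rack_gen (R : rackType) (S : set R) : set R :=
  smallest (@is_subrack R) S.

Lemma is_subrackP (R : rackType) (Q : set R) : is_subrack Q <->
  (forall a b, Q a -> Q b -> Q (a ▷ b)) /\
  (forall a x, Q a -> Q (a ▷ x) -> Q x).
Proof.
split=> [[QM _ QV]|[QM QV]].
  split=> // a x Qa Qax; have [y [[Qy ayE] _]] := QV _ _ Qa Qax.
  have [z [_ zP]] := rack_div a (a ▷ x).
  by rewrite -(zP x) // (zP y).
split=> // [*|a b Qa Qb]; first exact: rack_opD.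
have [x [axE xP]] := rack_div a b; exists x; split=> [|y [_ /xP//]].
by split=> //; apply: (QV a); rewrite ?axE.
Qed.

Lemma is_subrack_bigcap (R : rackType) (F : set (set R)) :
  (forall Q, F Q -> is_subrack Q) -> is_subrack (\bigcap_(Q in F) Q).
Proof.
move=> FP; apply/is_subrackP; split=> [a b Fa Fb|a x Fa Fax] Q FQ;
  have [QM QV] := (is_subrackP Q).1 (FP _ FQ).
  by apply: QM; [apply: Fa|apply: Fb].
by apply: (QV a); [apply: Fa|apply: Fax].
Qed.

Lemma is_subrack0 (R : rackType) : is_subrack (set0 : set R).
Proof. by split. Qed.

Lemma is_subrackT (R : rackType) : is_subrack (setT : set R).
Proof. by apply/is_subrackP. Qed.

Lemma is_subrackI (R : rackType) (P Q : set R) :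
  is_subrack P -> is_subrack Q -> is_subrack (P `&` Q).
Proof.
move=> /is_subrackP[PM PV] /is_subrackP[QM QV]; apply/is_subrackP.
split=> [a b [Pa Qa] [Pb Qb]|a x [Pa Qa] [Pax Qax]].
  by split; [apply: PM|apply: QM].
by split; [apply: (PV a)|apply: (QV a)].
Qed.

Lemma is_subrack_gen (R : rackType) (S : set R) : is_subrack (rack_gen S).
Proof. by apply: is_subrack_bigcap => Q []. Qed.

Record subrack (R : rackType) := Subrack {
  subrack_set :> set R;
  subrack_setP : is_subrack subrack_set
}.

Lemma subrack_inj (R : rackType) : injective (@subrack_set R).
Proof.
move=> [P Pp] [Q Qp] /= PQ; case: _ / PQ Qp => Qp.
by rewrite (Prop_irrelevance Pp Qp).
Qed.

HB.instance Definition _ (R : rackType) := gen_eqMixin (subrack R).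
HB.instance Definition _ (R : rackType) := gen_choiceMixin (subrack R).

Definition subrack_le (R : rackType) (P Q : subrack R) : bool := `[< P `<=` Q >].

Definition subrack_meet (R : rackType) (P Q : subrack R) : subrack R :=
  Subrack (is_subrackI (subrack_setP P) (subrack_setP Q)).

Definition subrack_join (R : rackType) (P Q : subrack R) : subrack R :=
  Subrack (is_subrack_gen (P `|` Q)).

Definition subrack_bot (R : rackType) : subrack R := Subrack (@is_subrack0 R).

Definition subrack_top (R : rackType) : subrack R := Subrack (@is_subrackT R).

Fact subrack_display : Order.disp_t. Proof. exact: Order.Disp tt tt. Qed.

Fact subrack_le_refl (R : rackType) : reflexive (@subrack_le R).
Proof. by move=> P; apply/asboolP. Qed.

Fact subrack_le_anti (R : rackType) : antisymmetric (@subrack_le R).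
Proof.
by move=> P Q /andP[/asboolP PQ /asboolP QP]; apply/subrack_inj/seteqP.
Qed.

Fact subrack_le_trans (R : rackType) : transitive (@subrack_le R).
Proof.
move=> Q P S /asboolP PQ /asboolP QS; apply/asboolP; exact: subset_trans QS.
Qed.

HB.instance Definition _ (R : rackType) :=
  Order.Le_isPOrder.Build subrack_display (subrack R)
    (@subrack_le_refl R) (@subrack_le_anti R) (@subrack_le_trans R).

Fact subrack_lexI (R : rackType) (S P Q : subrack R) :
  (S <= subrack_meet P Q)%O = (S <= P)%O && (S <= Q)%O.
Proof.
apply/asboolP/andP; rewrite subsetI => -[SP SQ].
  by split; apply/asboolP.
by split; apply/asboolP.
Qed.

Fact subrack_leUx (R : rackType) (P Q S : subrack R) :
  (subrack_join P Q <= S)%O = (P <= S)%O && (Q <= S)%O.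
Proof.
apply/asboolP/andP => [PQS|[/asboolP PS /asboolP QS]].
  have : P `|` Q `<=` S by apply: subset_trans PQS; exact: sub_gen_smallest.
  by rewrite subUset => -[PS QS]; split; apply/asboolP.
by apply: smallest_sub; [exact: subrack_setP|rewrite subUset].
Qed.

HB.instance Definition _ (R : rackType) :=
  Order.POrder_MeetJoin_isLattice.Build subrack_display (subrack R)
    (@subrack_lexI R) (@subrack_leUx R).

Fact subrack_le0x (R : rackType) (P : subrack R) : (subrack_bot R <= P)%O.
Proof. by apply/asboolP; exact: sub0set. Qed.

Fact subrack_lex1 (R : rackType) (P : subrack R) : (P <= subrack_top R)%O.
Proof. exact/asboolP. Qed.

HB.instance Definition _ (R : rackType) :=
  Order.hasBottom.Build subrack_display (subrack R) (@subrack_le0x R).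
HB.instance Definition _ (R : rackType) :=
  Order.hasTop.Build subrack_display (subrack R) (@subrack_lex1 R).

Lemma subrack_leE (R : rackType) (P Q : subrack R) :
  (P <= Q)%O = (P `<=` Q) :> Prop.
Proof. exact: asboolE. Qed.

Lemma subrack_meetE (R : rackType) (P Q : subrack R) :
  (P `&` Q)%O = P `&` Q :> set R.
Proof. by []. Qed.

Lemma subrack_joinE (R : rackType) (P Q : subrack R) :
  (P `|` Q)%O = rack_gen (P `|` Q) :> set R.
Proof. by []. Qed.

Lemma subrack_botE (R : rackType) : (\bot%O : subrack R) = set0 :> set R.
Proof. by []. Qed.

Lemma subrack_topE (R : rackType) : (\top%O : subrack R) = setT :> set R.
Proof. by []. Qed.

(* No distributivity: complements need not be unique, unlike in
   [ctbDistrLatticeType]. *)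
Definition complemented d (L : tbLatticeType d) : Prop :=
  forall x : L, exists y : L, (x `&` y = \bot)%O /\ (x `|` y = \top)%O.

Definition dihedral (V : zmodType) : Type := V.

Definition dihedral_op (V : zmodType) (x y : dihedral V) : dihedral V :=
  ((x : V) *+ 2 - (y : V))%R.

Fact dihedral_opD (V : zmodType) (a b c : dihedral V) :
  dihedral_op a (dihedral_op b c)
  = dihedral_op (dihedral_op a b) (dihedral_op a c).
Proof.
rewrite /dihedral_op mulrnBl; move: (a *+ 2)%R (b *+ 2)%R => u v.
by rewrite !opprB [RHS]addrC mulr2n !addrA subrK (addrC c).
Qed.

Fact dihedral_div (V : zmodType) (a b : dihedral V) :
  exists! x : dihedral V, dihedral_op a x = b.
Proof.
by exists (dihedral_op a b); split=> [|x <-]; rewrite /dihedral_op opprB addrC subrK.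
Qed.

HB.instance Definition _ (V : zmodType) :=
  isRack.Build (dihedral V) (@dihedral_opD V) (@dihedral_div V).

(* Main.v *)
Require Import Defs.
From mathcomp Require Import all_boot all_order all_algebra.
From mathcomp Require Import boolp classical_sets.
From mathcomp Require Import ring zify.

(** The singleton {0} has no complement. Suppose S is one, and pick a in S. Let
    K be the group of those k such that S is stable under translation by 2k.
    For x, y in S, composing two reflections shows x - y in K, so the subgroup
    K + Za contains both 0 and S, hence is all of Q. Thus Q/K is cyclic and
    divisible, so it is trivial, and 0 = a + 2(-a/2) lies in S. *)

Set Implicit Arguments.
Unset Strict Implicit.
Unset Printing Implicit Defensive.

Import Order.TTheory GRing.Theory Num.Theory.

Local Open Scope classical_set_scope.
Local Open Scope ring_scope.

Definition is_subgroup (V : zmodType) (G : set V) : Prop :=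
  G 0 /\ forall x y, G x -> G y -> G (x - y).

Section Subgroups.
Variables (V : zmodType) (G : set V).
Hypothesis Gg : is_subgroup G.

Lemma subgroupN x : G x -> G (- x).
Proof. by move=> Gx; rewrite -sub0r; apply: Gg.2 => //; exact: Gg.1. Qed.

Lemma subgroupD x y : G x -> G y -> G (x + y).
Proof. by move=> Gx /subgroupN Gy; rewrite -[y]opprK; exact: Gg.2. Qed.

Lemma subgroupMn x n : G x -> G (x *+ n).
Proof.
move=> Gx; elim: n => [|n IHn]; first exact: Gg.1.
by rewrite mulrS; exact: subgroupD.
Qed.

Lemma subgroupMz x (m : int) : G x -> G (x *~ m).
Proof. by case: m => n Gx; [|apply: subgroupN]; exact: subgroupMn. Qed.

(** Hence a subrack generated by a subset of a subgroup stays inside that subgroup. *)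
Lemma subgroup_is_subrack : is_subrack (G : set (dihedral V)).
Proof.
apply/is_subrackP; split=> [a b Ga Gb|a x Ga Gax].
  by apply: Gg.2 => //; exact: subgroupMn.
have -> : x = a *+ 2 - (a *+ 2 - x) :> V by rewrite subKr.
by apply: Gg.2 => //; exact: subgroupMn.
Qed.

Lemma subgroup_add_cycle (a : V) :
  is_subgroup [set z | exists k m, G k /\ z = k + a *~ m].
Proof.
split=> [|_ _ [k [m [Gk ->]]] [l [n [Gl ->]]]].
  by exists 0, 0; rewrite mulr0z addr0; split=> //; exact: Gg.1.
exists (k - l), (m - n); split; first exact: Gg.2.
by rewrite mulrzBr opprD addrACA.
Qed.

End Subgroups.

(** The class of [a] generates the quotient by [K]. Divisibility by 2 bounds its order, and
    divisibility by that bound then kills it. *)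
Lemma subgroup_cyclic_quotient_rat (K : set rat) (a : rat) : is_subgroup K ->
  (forall z, exists k m, K k /\ z = k + a *~ m) -> forall z, K z.
Proof.
move=> Kg Ka.
suff aK : K a.
  move=> z; have [k [m [Kk ->]]] := Ka z.
  by apply: subgroupD => //; exact: subgroupMz.
(* From [a / 2 = k + m a] follows [(1 - 2m) a = 2k], which lies in [K]; the coefficient is odd,
   hence nonzero. *)
have [k [m [Kk ak]]] := Ka (a / 2).
set N : int := 1 - m * 2.
have N0 : N%:~R != 0 :> rat by rewrite intr_eq0 /N; lia.
have KaN : K (a *~ N).
  have -> : a *~ N = k *+ 2.
    have -> : k = a / 2 - a *~ m by rewrite ak addrK.
    by rewrite -(mulrzr a N) -(mulrzr a m) rmorphB rmorphM /=; field.
  exact: subgroupMn.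
(* Multiplying [a / N = l + n a] by [N] gives [a = N l + n (N a)], with both terms in [K]. *)
have [l [n [Kl al]]] := Ka (a / N%:~R).
have -> : a = l *~ N + a *~ N *~ n.
  have -> : l = a / N%:~R - a *~ n by rewrite al addrK.
  by rewrite mulrzBl mulrzAC subrK -mulrzr divfK.
by apply: subgroupD => //; exact: subgroupMz.
Qed.

(** Recording [k] instead of the translation [2k] makes the differences of points of a subrack
    themselves members. *)
Definition half_periods (V : zmodType) (S : set V) : set V :=
  [set k | forall x, S x -> S (x + k *+ 2)].

Section HalfPeriods.
Variables (V : zmodType) (S : set V).
Hypothesis Sr : is_subrack (S : set (dihedral V)).

Lemma subrack_reflect x y : S x -> S y -> S (x *+ 2 - y).
Proof. by case: Sr => SM _ _; exact: SM. Qed.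

Lemma half_periods_diff x y : S x -> S y -> half_periods S (x - y).
Proof.
move=> Sx Sy z Sz; have -> : z + (x - y) *+ 2 = x *+ 2 - (y *+ 2 - z).
  by rewrite mulrnBl opprB addrCA.
by do 2 apply: subrack_reflect => //.
Qed.

Lemma half_periods_subgroup : is_subgroup (half_periods S).
Proof.
split=> [x Sx|k l Kk Kl x Sx]; first by rewrite mul0rn addr0.
(* Reflecting in x conjugates translation by 2l to translation by -2l. *)
have Sxl : S (x - l *+ 2).
  have -> : x - l *+ 2 = x *+ 2 - (x + l *+ 2).
    by rewrite (mulr2n x) addrKA.
  by apply: subrack_reflect => //; exact: Kl.
by rewrite mulrnBl addrA addrAC; exact: Kk.
Qed.

End HalfPeriods.

Lemma trivial_subgroup (V : zmodType) : is_subgroup ([set 0] : set V).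
Proof. by split=> // x y -> ->; rewrite subr0. Qed.

Theorem theorem5p2 : ~ complemented (subrack (dihedral rat)).
Proof.
move=> /(_ (Subrack (subgroup_is_subrack (trivial_subgroup rat)))).
move=> [[S Sr] [S0 S1]].
have {}S0 : ~ S (0 : rat).
  move=> S0'; suff : set0 (0 : rat) by [].
  by rewrite -[set0](congr1 (@subrack_set _) S0).
(* The join is the smallest subrack containing 0 and [S], so it is enough to test it against
   subgroups. *)
have {}S1 (G : set rat) : is_subgroup G -> S `<=` G -> forall z, G z.
  move=> Gg SG z.
  have : (setT : set rat) z by [].
  rewrite -[setT](congr1 (@subrack_set _) S1); apply: smallest_sub.
    exact: subgroup_is_subrack.
  by move=> x [->|/SG//]; exact: Gg.1.
(* An empty [S] would lie in the subgroup {0}, forcing 1 = 0. *)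
have [[a Sa]|nS] := pselect (exists a, S a); last first.
  have : (1 : rat) = 0; last by [].
  apply: (S1 [set 0]); first exact: trivial_subgroup.
  by move=> x Sx; case: nS; exists x.
have Kg := half_periods_subgroup Sr.
have KT : forall z, half_periods S z.
  apply: (@subgroup_cyclic_quotient_rat _ a) => //.
  apply: (S1 _ (subgroup_add_cycle Kg a)) => x Sx.
  exists ((x : rat) - a), 1; split; first exact: half_periods_diff.
  by rewrite mulr1z subrK.
apply: S0; have -> : 0 = a + (- (a : rat) / 2) *+ 2 :> rat by field.
exact: KT.
Qed.
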